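(* Let $r \ge 2$ and $k \ge 2$ be integers, and let $p$ be the largest prime with $p \le k$. Then $$w(r,k) > p\left(w\left(r - \left\lceil \tfrac{r}{p} \right\rceil, k\right) - 1\right).$$
   Context: For positive integers $r,k$, the van der Waerden number $w(r,k)$ is the least positive integer $N$ such that every coloring of $\{1,2,\dots,N\}$ with $r$ colors contains a monochromatic arithmetic progression of length $k$ (i.e. $x_1<\dots<x_k$ with constant difference $x_{i+1}-x_i=d\ge 1$, all of the same color). In particular $w(1,k)=k$. *)

(* Defs.v *)
From mathcomp Require Import all_boot.
From mathcomp Require Import boolp.
From mathcomp Require Import zify.

Set Implicit Arguments.
Unset Strict Implicit.
Unset Printing Implicit Defensive.

(* A colouring of {1, ..., N} is given by a total function on nat of which only
   the values on {1, ..., N} are consulted; for N > 0 every colouring of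
   {1, ..., N} extends to such a function. *)
Definition mono_ap (r k N : nat) (c : nat -> 'I_r) : Prop :=
  exists a d : nat, [/\ 0 < a, 0 < d &
    forall i, i < k -> a + i * d <= N /\ c (a + i * d) = c a].

Definition vdw_prop (r k N : nat) : Prop :=
  0 < N /\ forall c : nat -> 'I_r, mono_ap k N c.

(* Van der Waerden's theorem, by colour focusing; positions start at 0, and the
   term following the progression is also required to lie below N. *)
Definition vdw_thm (k : nat) : Prop := forall T : finType, exists N,
  forall c : nat -> T, exists a d,
    [/\ 0 < d, a + k * d < N & forall i, i < k -> c (a + i * d) = c a].

Lemma vdw_focus (k : nat) : vdw_thm k -> forall (T : finType) (m : nat),
  exists N, 0 < N /\ forall c : nat -> T,
    (exists a d, [/\ 0 < d, a + k * d < N &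
       forall i, i < k.+1 -> c (a + i * d) = c a]) \/
    (exists f (s : seq (nat * nat)),
      [/\ f < N, size s = m, uniq [seq c q.1 | q <- s] &
       forall q, q \in s -> [/\ 0 < q.2, q.1 + k * q.2 = f &
         forall i, i < k -> c (q.1 + i * q.2) = c q.1]]).
Proof.
move=> vk T; elim=> [|m [N [N0 IH]]].
  by exists 1; split=> // c; right; exists 0, [::]; split.
have [M HM] := vk {ffun 'I_N -> T}.
exists (M.+1 * N); split=> [|c]; first by rewrite muln_gt0.
have [A [D [D0 AM HC]]] := HM (fun b => [ffun j : 'I_N => c (b * N + j)]).
have blk i j : i < k -> j < N -> c ((A + i * D) * N + j) = c (A * N + j).
  by move=> /HC/ffunP E jN; have := E (Ordinal jN); rewrite !ffunE.
have [[a [d [d0 adN Hc]]]|[f [s [fN sm us Hs]]]] := IH (fun x => c (A * N + x)).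
  left; exists (A * N + a), d; split=> //; first by nia.
  by move=> i ik; rewrite -addnA Hc.
have [/mapP[[a d] /= qs cf]|fs] :=
    boolP (c (A * N + f) \in [seq c (A * N + q.1) | q <- s]).
  have /= [d0 adf Hc] := Hs _ qs.
  left; exists (A * N + a), d; split=> //; first by nia.
  move=> i; rewrite ltnS leq_eqVlt => /orP[/eqP->|ik].
    by rewrite -addnA adf.
  by rewrite -addnA Hc.
right; exists ((A + k * D) * N + f).
exists ((A * N + f, D * N) :: [seq (A * N + q.1, q.2 + D * N) | q <- s]).
split.
- by nia.
- by rewrite /= size_map sm.
- by rewrite /= -map_comp /comp /= fs.
move=> q; rewrite inE => /orP[/eqP->|/mapP[[a d] qs ->]] /=.
  split; [by nia | by nia |] => i ik.
  by rewrite -(blk i f) //; congr c; nia.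
have /= [d0 adf Hc] := Hs _ qs.
split; [by nia | by nia |] => i ik.
have lt : a + i * d < N by nia.
rewrite -[RHS](Hc i ik) -(blk i (a + i * d)) //; congr c; nia.
Qed.

Lemma vdw_thm_holds (k : nat) : vdw_thm k.
Proof.
elim: k => [|k IH] T; first by exists 1 => c; exists 0, 1; split.
have [N [N0 HN]] := vdw_focus IH T #|T|.+1.
exists (N + N) => c.
have [[a [d [d0 lt Hc]]]|[f [s [_ ss us _]]]] := HN c; last first.
  have := max_card (mem [seq c q.1 | q <- s]).
  by rewrite (card_uniqP us) size_map ss ltnn.
case: k IH HN Hc lt => [|k] IH HN Hc lt.
  exists 0, 1; split=> //; [by nia | by case].
by exists a, d; split=> //; nia.
Qed.

Lemma vdw_exists (r k : nat) : exists N, `[< vdw_prop r k N >].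
Proof.
have [N HN] := vdw_thm_holds k 'I_r.
exists N.+1; apply/asboolP; split=> // c.
have [a [d [d0 lt Hc]]] := HN (fun x => c x.+1).
exists a.+1, d; split=> // i ik; rewrite addSn Hc //; split=> //; nia.
Qed.

Definition w (r k : nat) : nat := ex_minn (vdw_exists r k).

Lemma wP (r k : nat) :
  vdw_prop r k (w r k) /\ forall N, vdw_prop r k N -> w r k <= N.
Proof.
rewrite /w; case: ex_minnP => N /asboolP HN min; split=> // M HM.
by apply: min; apply/asboolP.
Qed.

Lemma w1k (k : nat) : 0 < k -> w 1 k = k.
Proof.
move=> k0; have [[_ HN] min] := wP 1 k.
apply/eqP; rewrite eqn_leq; apply/andP; split.
  apply: min; split=> // c; exists 1, 1; split=> // i ik.
  by split; [lia | rewrite !ord1].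
have [a [d [a0 d0 H]]] := HN (fun=> ord0).
have lt : k.-1 < k by lia.
have [le _] := H _ lt; nia.
Qed.

(* Quotient rounded up, for 0 < n. *)
Definition ceil_div (m n : nat) : nat := (m + n.-1) %/ n.

(* Main.v *)
Require Import Defs.
From mathcomp Require Import all_boot.
From mathcomp Require Import boolp zify.

(** Write [t] for the ceiling of [r / p] and [M] for [w (r - t) k - 1], and fix
    a colouring of [{1, ..., M}] with [r - t] colours and no monochromatic
    progression of length [k].  Copy it onto each of the [p] residue classes in
    [{1, ..., p * M}], relabelling the colours in class [j] so that the block
    [{j * t, ..., j * t + t - 1}] is avoided.  A progression whose difference is
    divisible by [p] stays in one class, so it is not monochromatic.  Any other
    progression of length [k >= p] meets every class; since [r <= p * t], each
    colour is avoided by some class, so it is not monochromatic either. *)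

Lemma leq_mul_ceil_div (m n : nat) : 0 < n -> m <= n * ceil_div m n.
Proof.
move=> n0; rewrite /ceil_div.
have := divn_eq (m + n.-1) n; have := ltn_pmod (m + n.-1) n0; nia.
Qed.

Lemma coprime_ap_hits_residue (p d a j : nat) :
  0 < d -> coprime d p -> j < p ->
  exists2 i, i < p & (a + i * d) %% p = j.
Proof.
move=> d0 /eqP cop jp; have p0 : 0 < p by lia.
case: (egcdnP p d0) => u v; rewrite cop => uv _.
(* [u] inverts [d] modulo [p]; adding [p * a] keeps the subtraction of [a] from truncating. *)
exists ((u * (j + p * a - a)) %% p); first by rewrite ltn_pmod.
rewrite -modnDmr modnMml modnDmr.
have -> : a + u * (j + p * a - a) * d = (a + v * (j + p * a - a)) * p + j.
  have le : a <= p * a by rewrite leq_pmull.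
  rewrite mulnAC uv; nia.
by rewrite modnMDl modn_small.
Qed.

(** The increasing bijection from the naturals onto the complement of [[j * t, j * t + t)]. *)
Definition skip_block (t j i : nat) : nat := if i < j * t then i else i + t.

Lemma skip_block_bound (r t j : nat) (i : 'I_(r - t)) : skip_block t j i < r.
Proof. by have := ltn_ord i; rewrite /skip_block; case: ifP; lia. Qed.

Lemma skip_block_inj (t j : nat) : injective (skip_block t j).
Proof. by move=> x y; rewrite /skip_block; do 2 case: ifP; lia. Qed.

Lemma skip_block_avoids (t j i : nat) : 0 < t -> skip_block t j i %/ t != j.
Proof.
move=> t0; apply/eqP => E.
have := divn_eq (skip_block t j i) t.
have := ltn_pmod (skip_block t j i) t0.
by rewrite E /skip_block; case: ifP; lia.
Qed.

Definition interleave (r t p : nat) (c : nat -> 'I_(r - t)) (n : nat) : 'I_r :=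
  Ordinal (skip_block_bound r t (n.-1 %% p) (c (n.-1 %/ p).+1)).

Lemma interleave_no_mono_ap (r t k p M : nat) (c : nat -> 'I_(r - t)) :
  prime p -> p <= k -> 0 < t -> r <= p * t ->
  ~ mono_ap k M c -> ~ mono_ap k (p * M) (interleave r t p c).
Proof.
move=> pp pk t0 rpt nc [[|a] [d [//= _ d0 H]]].
have p0 := prime_gt0 pp.
have [/dvdnP[e de]|ndvd] := boolP (p %| d).
  (* Within one class, quotients by [p] form a progression of difference [e], shifted by one to
     start from 1. *)
  apply: nc; exists (a %/ p).+1, e; split=> //; first by nia.
  move=> i /H[]; rewrite addSn de mulnA addnC => le /(congr1 val) /=.
  rewrite modnMDl divnMDl // addnC => /skip_block_inj E.
  rewrite addSn; split; last exact: val_inj.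
  by rewrite addnC -divnMDl // ltn_divLR // [M * p]mulnC.
have cop : coprime d p by rewrite coprime_sym prime_coprime.
(* The first term's colour, divided by [t], indexes a class that avoids this colour. *)
have jp : interleave r t p c a.+1 %/ t < p.
  rewrite ltn_divLR //; exact: leq_trans (ltn_ord _) rpt.
have [i ip res] := coprime_ap_hits_residue p d a _ d0 cop jp.
have [_ /(congr1 val) /= E] := H i (leq_trans ip pk).
have := skip_block_avoids t ((a + i * d) %% p) (c ((a + i * d) %/ p).+1) t0.
by rewrite E res => /eqP[].
Qed.

Lemma mono_ap_widen (r k M N : nat) (c : nat -> 'I_r) :
  M <= N -> mono_ap k M c -> mono_ap k N c.
Proof.
move=> MN [a [d [a0 d0 H]]]; exists a, d; split=> // i /H[le E]; split=> //.
exact: leq_trans le MN.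
Qed.

Lemma exists_ap_free (r k N : nat) :
  0 < N -> N < w r k -> exists c : nat -> 'I_r, ~ mono_ap k N c.
Proof.
move=> N0 Nw; apply/existsNP => HN.
have [_ /(_ N (conj N0 HN))] := wP r k; lia.
Qed.

Theorem theorem2 (r k p : nat) (hr : 2 <= r) (hk : 2 <= k)
  (p_prime : prime p) (p_le_k : p <= k)
  (p_max : forall q : nat, prime q -> q <= k -> q <= p) :
  w r k > p * (w (r - ceil_div r p) k - 1).
Proof.
have [[w0 Hw] _] := wP r k.
have rpt := leq_mul_ceil_div r p (prime_gt0 p_prime).
have t0 : 0 < ceil_div r p by nia.
set s := r - _; have [M0|M0] := posnP (w s k - 1); first by rewrite M0 muln0.
have Mw : w s k - 1 < w s k by lia.
have [c nc] := exists_ap_free _ _ _ M0 Mw.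
rewrite ltnNge; apply/negP => le.
apply: (interleave_no_mono_ap _ _ _ _ _ _ p_prime p_le_k t0 rpt nc).
exact: mono_ap_widen le (Hw _).
Qed.
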